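(* Let $\mu=(\mu_1,\dots,\mu_m\,|\,\mu_{m+1},\dots,\mu_{m+n})$ be a composition of $(M|N)$. The super Yangian $Y(\mathfrak{gl}_{M|N})$ is generated as an algebra by the elements \[\{D_{a;i,j}^{(r)},\,D_{a;i,j}^{\prime(r)} : 1\le a\le m+n,\ 1\le i,j\le\mu_a,\ r\ge 0\},\] \[\{E_{a;i,j}^{(r)} : 1\le a<m+n,\ 1\le i\le\mu_a,\ 1\le j\le\mu_{a+1},\ r\ge1\},\] \[\{F_{a;i,j}^{(r)} : 1\le a<m+n,\ 1\le i\le\mu_{a+1},\ 1\le j\le\mu_{a},\ r\ge1\}.\]
   Context: Super Yangian. Let $M,N\ge0$ be integers, not both zero. For $1\le i\le M+N$ put $\mathrm{par}(i)=0$ if $i\le M$ and $\mathrm{par}(i)=1$ if $i>M$. The super Yangian $Y(\mathfrak{gl}_{M|N})$ is the unital associative superalgebra over $\mathbb{C}$ with generators $t_{ij}^{(r)}$ ($1\le i,j\le M+N$, $r\ge1$), $t_{ij}^{(r)}$ having parity $\mathrm{par}(i)+\mathrm{par}(j)$, and, with $t_{ij}^{(0)}:=\delta_{ij}$, defining relations \[[t_{ij}^{(r)},t_{hk}^{(s)}]=(-1)^{\mathrm{par}(i)\mathrm{par}(j)+\mathrm{par}(i)\mathrm{par}(h)+\mathrm{par}(j)\mathrm{par}(h)}\sum_{t=0}^{\min(r,s)-1}\big(t_{hj}^{(t)}t_{ik}^{(r+s-1-t)}-t_{hj}^{(r+s-1-t)}t_{ik}^{(t)}\big),\] where $[x,y]=xy-(-1)^{|x||y|}yx$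 is the supercommutator. Put $t_{ij}(u)=\sum_{r\ge0}t_{ij}^{(r)}u^{-r}$ and $T(u)=(t_{ij}(u))_{1\le i,j\le M+N}$, a matrix with entries in $Y(\mathfrak{gl}_{M|N})[[u^{-1}]]$; such matrices are multiplied in the usual way (no extra signs). Composition. Let $\lambda=(\lambda_1,\dots,\lambda_m)$ be a composition of $M$ and $\nu=(\nu_1,\dots,\nu_n)$ a composition of $N$ (positive parts). Put $\mu_i=\lambda_i$ for $1\le i\le m$, $\mu_{m+j}=\nu_j$ for $1\le j\le n$; then $\mu=(\mu_1,\dots,\mu_m|\mu_{m+1},\dots,\mu_{m+n})$ is called a composition of $(M|N)$. Gauss decomposition. View $T(u)$ as an $(m+n)\times(m+n)$ block matrix whose $(a,b)$ block has size $\mu_a\times\mu_b$. There is a unique factorization $T(u)=F(u)D(u)E(u)$ with $D(u)$ block diagonal with diagonal blocks $D_a(u)$, $E(u)$ block upper unitriangular with blocks $E_{a,b}(u)$ ($a<b$), and $F(u)$ block lower unitriangular with blocks $F_{b,a}(u)$ ($a<b$). Let $D'_a(u)=D_a(u)^{-1}$. Write $D_{a;i,j}(u)=\sum_{r\ge0}D_{a;i,j}^{(r)}u^{-r}$, $D'_{a;i,j}(u)=\sum_{r\ge0}D_{a;i,j}^{\prime(r)}u^{-r}$, $E_{a,b;i,j}(u)=\sum_{r\ge1}E_{a,b;i,j}^{(r)}u^{-r}$, $F_{b,a;i,j}(u)=\sum_{r\ge1}F_{b,a;i,j}^{(r)}u^{-r}$ for the $(i,j)$ entries, and $E_{a;i,j}^{(r)}:=E_{a,a+1;i,j}^{(r)}$,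 $F_{a;i,j}^{(r)}:=F_{a+1,a;i,j}^{(r)}$ for $1\le a<m+n$. *)

(* Defs.v *)
From HB Require Import structures.
From mathcomp Require Import all_boot all_order all_algebra.
From mathcomp Require Import boolp.
From mathcomp Require Import monalg.
From mathcomp Require Import zify.

Set Implicit Arguments.
Unset Strict Implicit.
Unset Printing Implicit Defensive.

Import GRing.Theory.
Local Open Scope ring_scope.
Local Open Scope quotient_scope.

(* The free unital associative algebra on I: [{malg K[{fmonom I}]}] is the
   monoid algebra of the free monoid on I. *)
Definition free_alg (K : comNzRingType) (I : choiceType) : Type :=
  {malg K[{fmonom I}]}.

Section FreeAlgebra.
Variables (K : comNzRingType) (I : choiceType).

HB.instance Definition _ :=
  GRing.Lalgebra.copy (free_alg K I) {malg K[{fmonom I}]}.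

Fact free_scalerAr (c : K) (x y : free_alg K I) : c *: (x * y) = x * (c *: y).
Proof.
have malg_cC (z : {malg K[{fmonom I}]}) : z * c%:MP = c%:MP * z.
  rewrite !malgM_def fgmulgU fgmulUg.
  by apply: eq_bigr => k _; rewrite mulm1 mul1m mulrC.
rewrite -[LHS]mul_malgC -[c *: y]mul_malgC.
by rewrite [LHS]mulrA -[in LHS]malg_cC -mulrA.
Qed.

HB.instance Definition _ :=
  GRing.Lalgebra_isAlgebra.Build K (free_alg K I) free_scalerAr.

Definition free_gen (i : I) : free_alg K I := << fmu i >>.

End FreeAlgebra.

Inductive ideal_span (A : pzRingType) (S : A -> Prop) : A -> Prop :=
| ideal_gen x : S x -> ideal_span S x
| ideal_zero : ideal_span S 0
| ideal_sub x y : ideal_span S x -> ideal_span S y -> ideal_span S (x - y)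
| ideal_mull a x : ideal_span S x -> ideal_span S (a * x)
| ideal_mulr a x : ideal_span S x -> ideal_span S (x * a).

Section QuotientAlgebra.
Variables (K : comNzRingType) (A : algType K) (S : A -> Prop).
(* MathComp's [algType]s are nontrivial, whence properness. *)
Hypothesis S1 : ~ ideal_span S 1.
Let J := ideal_span S.

Fact ideal_spanN x : J x -> J (- x).
Proof.
by move=> Jx; rewrite -sub0r; apply: ideal_sub Jx; exact: ideal_zero.
Qed.

Fact ideal_spanD x y : J x -> J y -> J (x + y).
Proof. by move=> Jx Jy; rewrite -[y]opprK; apply/ideal_sub/ideal_spanN. Qed.

Fact ideal_spanZ (c : K) x : J x -> J (c *: x).
Proof. by move=> Jx; rewrite -[x]mul1r scalerAl; apply: ideal_mull. Qed.

Definition eqmod (x y : A) := `[< J (x - y) >].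

Fact eqmod_equiv : equiv_class_of eqmod.
Proof.
split=> [x|x y|y x z].
- by apply/asboolP; rewrite subrr; exact: ideal_zero.
- by apply/asboolP/asboolP => /ideal_spanN; rewrite opprB.
- move=> /asboolP Jxy /asboolP Jyz; apply/asboolP.
  by rewrite -[x](addrNK y) -addrA; apply: ideal_spanD.
Qed.

Canonical eqmod_equivrel := EquivRelPack eqmod_equiv.
Canonical eqmod_encModRel := defaultEncModRel eqmod.

Definition quot_alg of ~ ideal_span S 1 := {eq_quot eqmod}.
Local Notation Q := (quot_alg S1).

HB.instance Definition _ : EqQuotient A eqmod Q := EqQuotient.on Q.
HB.instance Definition _ := Choice.on Q.

Fact quot_eqP x y : J (x - y) <-> \pi_Q x = \pi_Q y.
Proof.
split=> [Jxy|/eqP]; first by apply/eqP; rewrite piE; apply/asboolP.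
by rewrite piE => /asboolP.
Qed.

Definition quot_add (x y : Q) : Q := \pi_Q (repr x + repr y).
Definition quot_opp (x : Q) : Q := \pi_Q (- repr x).
Definition quot_mul (x y : Q) : Q := \pi_Q (repr x * repr y).
Definition quot_scale (c : K) (x : Q) : Q := \pi_Q (c *: repr x).

Fact quot_repr_pi x : J (repr (\pi_Q x) - x).
Proof. by apply/quot_eqP; rewrite reprK. Qed.

Fact quot_pi_add x y : quot_add (\pi_Q x) (\pi_Q y) = \pi_Q (x + y).
Proof.
apply/quot_eqP; rewrite opprD addrACA.
by apply: ideal_spanD; exact: quot_repr_pi.
Qed.

Fact quot_pi_opp x : quot_opp (\pi_Q x) = \pi_Q (- x).
Proof. by apply/quot_eqP; rewrite -opprD; apply/ideal_spanN/quot_repr_pi. Qed.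

Fact quot_pi_mul x y : quot_mul (\pi_Q x) (\pi_Q y) = \pi_Q (x * y).
Proof.
apply/quot_eqP; rewrite -[_ * _](addrNK (x * repr (\pi_Q y))) -mulrBl -addrA.
rewrite -mulrBr; apply: ideal_spanD.
  by apply/ideal_mulr/quot_repr_pi.
by apply/ideal_mull/quot_repr_pi.
Qed.

Fact quot_pi_scale c x : quot_scale c (\pi_Q x) = \pi_Q (c *: x).
Proof.
by apply/quot_eqP; rewrite -scalerBr; apply/ideal_spanZ/quot_repr_pi.
Qed.

Let piW (P : Q -> Prop) : (forall x, P (\pi_Q x)) -> forall q, P q.
Proof. by move=> Px q; rewrite -[q]reprK. Qed.

Fact quot_addA : associative quot_add.
Proof. by do 3!elim/piW=> ?; rewrite !quot_pi_add addrA. Qed.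
Fact quot_addC : commutative quot_add.
Proof. by do 2!elim/piW=> ?; rewrite !quot_pi_add addrC. Qed.
Fact quot_add0 : left_id (\pi_Q 0) quot_add.
Proof. by elim/piW=> ?; rewrite quot_pi_add add0r. Qed.
Fact quot_addN : left_inverse (\pi_Q 0) quot_opp quot_add.
Proof. by elim/piW=> ?; rewrite quot_pi_opp quot_pi_add addNr. Qed.

HB.instance Definition _ :=
  GRing.isZmodule.Build Q quot_addA quot_addC quot_add0 quot_addN.

Fact quot_mulA : associative quot_mul.
Proof. by do 3!elim/piW=> ?; rewrite !quot_pi_mul mulrA. Qed.
Fact quot_mul1l : left_id (\pi_Q 1) quot_mul.
Proof. by elim/piW=> ?; rewrite quot_pi_mul mul1r. Qed.
Fact quot_mul1r : right_id (\pi_Q 1) quot_mul.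
Proof. by elim/piW=> ?; rewrite quot_pi_mul mulr1. Qed.
Fact quot_mulDl : left_distributive quot_mul +%R.
Proof.
do 3!elim/piW=> ?.
by rewrite /GRing.add /= quot_pi_add !quot_pi_mul quot_pi_add mulrDl.
Qed.
Fact quot_mulDr : right_distributive quot_mul +%R.
Proof.
do 3!elim/piW=> ?.
by rewrite /GRing.add /= quot_pi_add !quot_pi_mul quot_pi_add mulrDr.
Qed.
Fact quot_1neq0 : \pi_Q 1 != 0.
Proof. by apply/eqP => /quot_eqP; rewrite subr0. Qed.

HB.instance Definition _ := GRing.Zmodule_isNzRing.Build Q
  quot_mulA quot_mul1l quot_mul1r quot_mulDl quot_mulDr quot_1neq0.

Fact quot_scaleA a b v : quot_scale a (quot_scale b v) = quot_scale (a * b) v.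
Proof. by elim/piW: v => x; rewrite !quot_pi_scale scalerA. Qed.
Fact quot_scale1 : left_id 1 quot_scale.
Proof. by elim/piW=> x; rewrite quot_pi_scale scale1r. Qed.
Fact quot_scaleDr : right_distributive quot_scale +%R.
Proof.
move=> c; do 2!elim/piW=> ?.
by rewrite /GRing.add /= quot_pi_add !quot_pi_scale quot_pi_add scalerDr.
Qed.
Fact quot_scaleDl v : {morph quot_scale^~ v : a b / a + b}.
Proof.
elim/piW: v => x a b.
by rewrite !quot_pi_scale [RHS]quot_pi_add scalerDl.
Qed.

HB.instance Definition _ := GRing.Zmodule_isLmodule.Build K Q
  quot_scaleA quot_scale1 quot_scaleDr quot_scaleDl.

Fact quot_scaleAl (c : K) (x y : Q) : c *: (x * y) = (c *: x) * y.
Proof.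
elim/piW: x => x; elim/piW: y => y; rewrite /GRing.scale /GRing.mul /=.
by rewrite quot_pi_mul !quot_pi_scale quot_pi_mul scalerAl.
Qed.

HB.instance Definition _ := GRing.Lmodule_isLalgebra.Build K Q quot_scaleAl.

Fact quot_scaleAr (c : K) (x y : Q) : c *: (x * y) = x * (c *: y).
Proof.
elim/piW: x => x; elim/piW: y => y; rewrite /GRing.scale /GRing.mul /=.
by rewrite quot_pi_mul !quot_pi_scale quot_pi_mul scalerAr.
Qed.

HB.instance Definition _ := GRing.Lalgebra_isAlgebra.Build K Q quot_scaleAr.

Definition quot_map (x : A) : Q := \pi_Q x.

Fact quot_map_is_zmod_morphism : zmod_morphism quot_map.
Proof.
by move=> x y; rewrite /quot_map -quot_pi_add -quot_pi_opp.
Qed.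
HB.instance Definition _ :=
  GRing.isZmodMorphism.Build A Q quot_map quot_map_is_zmod_morphism.

Fact quot_map_is_monoid_morphism : monoid_morphism quot_map.
Proof. by split=> // x y; rewrite /quot_map -quot_pi_mul. Qed.
HB.instance Definition _ :=
  GRing.isMonoidMorphism.Build A Q quot_map quot_map_is_monoid_morphism.

Fact quot_map_is_scalable : scalable quot_map.
Proof. by move=> c x; rewrite /quot_map -quot_pi_scale. Qed.
HB.instance Definition _ :=
  GRing.isScalable.Build K A Q *:%R quot_map quot_map_is_scalable.

Fact quot_map_surj (q : Q) : exists x, q = quot_map x.
Proof. by exists (repr q); rewrite /quot_map reprK. Qed.

Fact quot_map_eq0 x : quot_map x = 0 <-> ideal_span S x.
Proof. by rewrite -[x in ideal_span S x]subr0; split=> /quot_eqP. Qed.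

End QuotientAlgebra.

(* [{pred A}] ranges over all subsets of A, since [asbool] makes every
   predicate boolean. *)
Definition generates_algebra (K : comNzRingType) (A : algType K)
    (S : A -> Prop) : Prop :=
  forall U : {pred A}, subalg_closed U -> (forall x, S x -> x \in U) ->
  forall x, x \in U.

(* Indices are 0-based: [i : 'I_(M + N)] stands for i + 1. *)
Definition par (M N : nat) (i : 'I_(M + N)) : nat := (M <= i)%N.

(* [p] and [q] are the parities of [x] and [y]; they are passed explicitly, as
   the Z/2-grading enters the presentation only through the signs of
   supercommutators of generators, t_ij^(r) having parity par i + par j. *)
Definition supercomm (A : pzRingType) (p q : nat) (x y : A) : A :=
  x * y - (-1) ^+ (p * q) * (y * x).

(* [(i, j, r)] indexes the generator t_ij^(r+1). *)
Definition yangian_index (M N : nat) : choiceType :=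
  ('I_(M + N) * 'I_(M + N) * nat)%type.

Definition yangian_free (K : comNzRingType) (M N : nat) : algType K :=
  free_alg K (yangian_index M N).

(* The defining relation of the super Yangian, as an element that has to vanish,
   for a family [t i j r] in an arbitrary ring. *)
Definition yangian_relator (A : pzRingType) (M N : nat)
    (t : 'I_(M + N) -> 'I_(M + N) -> nat -> A)
    (i j h k : 'I_(M + N)) (r s : nat) : A :=
  supercomm (par i + par j) (par h + par k) (t i j r) (t h k s)
  - (-1) ^+ (par i * par j + par i * par h + par j * par h) *
    \sum_(0 <= q < minn r s)
      (t h j q * t i k (r + s - 1 - q)%N - t h j (r + s - 1 - q)%N * t i k q).

Fact yangian_relator0 (A B : pzRingType) (M N : nat)
    (t : 'I_(M + N) -> 'I_(M + N) -> nat -> A) (eps : A -> B) :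
  {morph eps : x y / x - y} -> {morph eps : x y / x * y} -> eps 0 = 0 ->
  (forall i j r, (0 < r)%N -> eps (t i j r) = 0) ->
  forall i j h k r s, (0 < r)%N -> (0 < s)%N ->
  eps (yangian_relator t i j h k r s) = 0.
Proof.
move=> epsB epsM eps0 epst i j h k r s r0 s0.
have epsD : {morph eps : x y / x + y}.
  have epsN x : eps (- x) = - eps x by rewrite -sub0r epsB eps0 sub0r.
  by move=> x y; rewrite -[y in LHS]opprK epsB epsN opprK.
rewrite /yangian_relator /supercomm !(epsB, epsM) !epst //.
rewrite (big_morph eps epsD eps0) big_nat big1.
  by rewrite !(mul0r, mulr0, subrr).
move=> q /=; rewrite leq_min => /andP[qr qs].
have k0 : (0 < r + s - 1 - q)%N by lia.
by rewrite epsB !epsM !(epst _ _ _ k0) mulr0 mul0r subrr.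
Qed.

Fact yangian_relator_morph (A B : pzRingType) (f : {rmorphism A -> B})
    (M N : nat) (t : 'I_(M + N) -> 'I_(M + N) -> nat -> A) i j h k r s :
  f (yangian_relator t i j h k r s)
    = yangian_relator (fun i' j' r' => f (t i' j' r')) i j h k r s.
Proof.
rewrite /yangian_relator /supercomm !(rmorphB, rmorphM, rmorph_sign) rmorph_sum.
by congr (_ - _ * _); apply: eq_bigr => q _; rewrite rmorphB !rmorphM.
Qed.

Section SuperYangian.
Variables (K : comNzRingType) (M N : nat).
Local Notation F := (yangian_free K M N).

Definition tfree (i j : 'I_(M + N)) (r : nat) : F :=
  if r is r'.+1 then free_gen K ((i, j, r') : yangian_index M N)
  else (i == j)%:R.

Inductive yangian_rel : F -> Prop :=
| YangianRel i j h k r s of (0 < r)%N & (0 < s)%N :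
    yangian_rel (yangian_relator tfree i j h k r s).

Let augmentation : exists eps : F -> K,
  [/\ {morph eps : x y / x - y}, {morph eps : x y / x * y}, eps 0 = 0, eps 1 = 1
    & forall i j r, (0 < r)%N -> eps (tfree i j r) = 0].
Proof.
pose L := {fmonom yangian_index M N}; exists (@mcoeff L K (@mone L)).
split; [exact: raddfB|exact: rmorphM|exact: raddf0|exact: rmorph1|].
move=> i j [//|r] _; rewrite /tfree /free_gen mcoeffU.
by rewrite -fdeg_eq0 fdegE fmuE.
Qed.

Fact yangian_rel_proper : ~ ideal_span yangian_rel 1.
Proof.
case: augmentation => eps [epsB epsM eps0 eps1 epst].
suff eps_ideal x : ideal_span yangian_rel x -> eps x = 0.
  by move=> /eps_ideal/eqP; rewrite eps1 oner_eq0.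
elim=> {x} [x [i j h k r s r0 s0]| |x y _ Hx _ Hy|a x _ Hx|a x _ Hx].
- exact: yangian_relator0.
- exact: eps0.
- by rewrite epsB Hx Hy subrr.
- by rewrite epsM Hx mulr0.
- by rewrite epsM Hx mul0r.
Qed.

Definition yangian : algType K := quot_alg yangian_rel_proper.

Definition tgen (i j : 'I_(M + N)) (r : nat) : yangian :=
  quot_map yangian_rel_proper (tfree i j r).

Lemma tgen0 i j : tgen i j 0 = (i == j)%:R.
Proof. exact: rmorph_nat. Qed.

Lemma tgen_relation i j h k r s : (0 < r)%N -> (0 < s)%N ->
  yangian_relator tgen i j h k r s = 0.
Proof.
move=> r0 s0; rewrite -(yangian_relator_morph (quot_map yangian_rel_proper)).
by apply/quot_map_eq0/ideal_gen.
Qed.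

End SuperYangian.

(* [scoef f r] is the coefficient of u^(-r) in f(u). *)
Record series (A : Type) := Series { scoef : nat -> A }.

Section SeriesRing.
Variable A : nzRingType.
Local Notation SA := (series A).

HB.instance Definition _ := gen_eqMixin SA.
HB.instance Definition _ := gen_choiceMixin SA.

Fact series_ext (f g : SA) : scoef f =1 scoef g -> f = g.
Proof. by case: f g => [f] [g] /= /funext ->. Qed.

Definition series_const (a : A) : SA :=
  Series (fun r => if r is 0 then a else 0).
Definition series_add (f g : SA) : SA :=
  Series (fun r => scoef f r + scoef g r).
Definition series_opp (f : SA) : SA := Series (fun r => - scoef f r).
Definition series_mul (f g : SA) : SA :=
  Series (fun r => \sum_(k < r.+1) scoef f k * scoef g (r - k)).

Fact series_addA : associative series_add.
Proof. by move=> f g h; apply: series_ext => r /=; rewrite addrA. Qed.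
Fact series_addC : commutative series_add.
Proof. by move=> f g; apply: series_ext => r /=; rewrite addrC. Qed.
Fact series_add0 : left_id (series_const 0) series_add.
Proof. by move=> f; apply: series_ext => -[|r] /=; rewrite add0r. Qed.
Fact series_addN : left_inverse (series_const 0) series_opp series_add.
Proof. by move=> f; apply: series_ext => -[|r] /=; rewrite addNr. Qed.

HB.instance Definition _ :=
  GRing.isZmodule.Build SA series_addA series_addC series_add0 series_addN.

Let trunc (n : nat) (f : SA) : {poly A} := \poly_(i < n.+1) scoef f i.

Let coef_trunc n f i : (i <= n)%N -> (trunc n f)`_i = scoef f i.
Proof. by move=> lin; rewrite coef_poly ltnS lin. Qed.

Let series_mulE n f g i : (i <= n)%N ->
  scoef (series_mul f g) i = (trunc n f * trunc n g)`_i.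
Proof.
move=> lin; rewrite coefM; apply: eq_bigr => k _.
by rewrite !coef_trunc //; have := ltn_ord k; lia.
Qed.

Fact series_mulA : associative series_mul.
Proof.
move=> f g h; apply: series_ext => r; rewrite !(@series_mulE r) //.
transitivity (trunc r f * trunc r g * trunc r h)`_r; last first.
  rewrite !coefM; apply: eq_bigr => k _.
  by rewrite [in RHS]coef_trunc ?leq_ord // (@series_mulE r) ?leq_ord.
rewrite -mulrA !coefM; apply: eq_bigr => k _.
by rewrite [in LHS](coef_trunc (series_mul g h)) ?leq_subr // (@series_mulE r)
  ?leq_subr.
Qed.
Fact series_mul1l : left_id (series_const 1) series_mul.
Proof.
move=> f; apply: series_ext => r /=.
by rewrite big_ord_recl /= mul1r subn0 big1 ?addr0 // => i _; rewrite mul0r.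
Qed.
Fact series_mul1r : right_id (series_const 1) series_mul.
Proof.
move=> f; apply: series_ext => r /=; rewrite big_ord_recr /= subnn mulr1.
rewrite big1 ?add0r // => i _.
by case: (r - i)%N (subn_gt0 i r) => [|k _]; rewrite ?ltn_ord ?mulr0.
Qed.
Fact series_mulDl : left_distributive series_mul +%R.
Proof.
move=> f g h; apply: series_ext => r /=; rewrite -big_split /=.
by apply: eq_bigr => i _; rewrite mulrDl.
Qed.
Fact series_mulDr : right_distributive series_mul +%R.
Proof.
move=> f g h; apply: series_ext => r /=; rewrite -big_split /=.
by apply: eq_bigr => i _; rewrite mulrDr.
Qed.
Fact series_1neq0 : series_const 1 != 0.
Proof.
by apply/eqP => /(congr1 (fun f => scoef f 0)) /eqP; rewrite oner_eq0.
Qed.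

HB.instance Definition _ := GRing.Zmodule_isNzRing.Build SA
  series_mulA series_mul1l series_mul1r series_mulDl series_mulDr series_1neq0.

End SeriesRing.

Definition tseries (K : comNzRingType) (M N : nat) (i j : 'I_(M + N)) :
  series (yangian K M N) := Series (tgen K i j).

Definition Tmx (K : comNzRingType) (M N : nat) :
    'M[series (yangian K M N)]_(M + N) :=
  \matrix_(i, j) tseries K i j.

Definition is_composition (l : nat) (c : 'I_l -> nat) (M : nat) : Prop :=
  (forall a, (0 < c a)%N) /\ (\sum_a c a = M)%N.

Definition join_comp (m n : nat) (lambda : 'I_m -> nat) (nu : 'I_n -> nat)
    (a : 'I_(m + n)) : nat :=
  match split a with inl i => lambda i | inr j => nu j end.

Lemma join_comp_sum (M N m n : nat) (lambda : 'I_m -> nat) (nu : 'I_n -> nat) :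
  is_composition lambda M -> is_composition nu N ->
  (M + N = \sum_a join_comp lambda nu a)%N.
Proof.
move=> [_ <-] [_ <-]; rewrite big_split_ord /join_comp.
congr addn; apply: eq_bigr => i _.
  by rewrite -[lshift n i]/(unsplit (inl i)) unsplitK.
by rewrite -[rshift m i]/(unsplit (inr i)) unsplitK.
Qed.

Section Gauss.
Variables (R : nzRingType) (l : nat) (mu : 'I_l -> nat).
Local Notation MX := 'M[R]_(\sum_a mu a).

Definition block_diagonal (A : MX) : Prop :=
  forall a b, a != b -> submxblock A a b = 0.

Definition block_upper_unitri (A : MX) : Prop :=
  (forall a, submxblock A a a = 1%:M) /\
  (forall a b : 'I_l, (b < a)%N -> submxblock A a b = 0).

Definition block_lower_unitri (A : MX) : Prop :=
  (forall a, submxblock A a a = 1%:M) /\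
  (forall a b : 'I_l, (a < b)%N -> submxblock A a b = 0).

Definition gauss_decomposition (T F D E : MX) : Prop :=
  [/\ T = F *m D *m E, block_lower_unitri F, block_diagonal D
    & block_upper_unitri E].

End Gauss.

Definition inverse_mx (R : nzRingType) (k : nat) (A B : 'M[R]_k) : Prop :=
  A *m B = 1%:M /\ B *m A = 1%:M.

Section GaussExists.
Variable A : nzRingType.

Definition coef_mx k l (r : nat) (X : 'M[series A]_(k, l)) : 'M[A]_(k, l) :=
  map_mx (fun f => scoef f r) X.

Fact strong_rec (B : Type) (d : B) (step : nat -> (nat -> B) -> B) :
  exists f, forall n, f n = step n (fun k => if (k < n)%N then f k else d).
Proof.
pose gs := fix gs n := if n is n'.+1 then
  rcons (gs n') (step n' (nth d (gs n'))) else [::].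
have sz n : size (gs n) = n by elim: n => //= n IH; rewrite size_rcons IH.
have gsE n k : (k < n)%N -> nth d (gs n) k = step k (nth d (gs k)).
  elim: n => //= n IH; rewrite ltnS nth_rcons sz leq_eqVlt.
  by case: eqVneq => [->|] /=; rewrite ?ltnn // => _ kn; rewrite kn IH.
exists (fun n => nth d (gs n.+1) n) => n; rewrite gsE //.
congr step; apply/funext => k; case: ifP => kn; first by rewrite !gsE.
by rewrite nth_default // sz leqNgt kn.
Qed.

Fact coef_mxP k l (X Y : 'M[series A]_(k, l)) :
  (forall r, coef_mx r X = coef_mx r Y) -> X = Y.
Proof.
by move=> XY; apply/matrixP => i j; apply: series_ext => r;
  have /matrixP/(_ i j) := XY r; rewrite !mxE.
Qed.

Fact coef_mxM k l n r (X : 'M[series A]_(k, l)) (Y : 'M_(l, n)) :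
  coef_mx r (X *m Y) = \sum_(s < r.+1) coef_mx s X *m coef_mx (r - s) Y.
Proof.
have scoefD : {morph (fun f : series A => scoef f r) : f g / f + g} by [].
apply/matrixP => i j; rewrite !mxE (big_morph _ scoefD (id1 := 0)); last first.
  by case: r {scoefD}.
rewrite summxE.
transitivity (\sum_t \sum_(s < r.+1) scoef (X i t) s * scoef (Y t j) (r - s)).
  by [].
rewrite exchange_big /=; apply: eq_bigr => s _.
by rewrite mxE; apply: eq_bigr => t _; rewrite !mxE.
Qed.

Fact coef_mx1 k r :
  coef_mx r (1%:M : 'M[series A]_k) = if r is 0 then 1%:M else 0.
Proof.
by apply/matrixP => i j; rewrite !mxE; case: r; rewrite ?mxE; case: (i == j).
Qed.

Let mx_of k l (f : nat -> 'M[A]_(k, l)) : 'M[series A]_(k, l) :=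
  \matrix_(i, j) Series (fun r => f r i j).

Let coef_mx_of k l (f : nat -> 'M[A]_(k, l)) r : coef_mx r (mx_of f) = f r.
Proof. by apply/matrixP => i j; rewrite !mxE. Qed.

Fact right_inv k (X : 'M[series A]_k) : coef_mx 0 X = 1%:M ->
  exists2 Y, X *m Y = 1%:M & coef_mx 0 Y = 1%:M.
Proof.
move=> X0.
have [f fE] := strong_rec 0 (fun r (g : nat -> 'M[A]_k) => if r is r'.+1 then
  - \sum_(s < r'.+1) coef_mx s.+1 X *m g (r' - s)%N else 1%:M).
have f0 : f 0 = 1%:M by rewrite fE.
exists (mx_of f); last by rewrite coef_mx_of f0.
apply: coef_mxP => -[|r]; rewrite coef_mx1 coef_mxM big_ord_recl /= X0 mul1mx.
  by rewrite subn0 coef_mx_of f0 big_ord0 addr0.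
rewrite subn0 coef_mx_of fE addrC; apply/eqP; rewrite subr_eq0; apply/eqP.
apply: eq_bigr => s _; rewrite coef_mx_of subSS.
by rewrite ltnS leq_subr.
Qed.

Fact inv_exists k (X : 'M[series A]_k) : coef_mx 0 X = 1%:M ->
  exists Y, inverse_mx X Y.
Proof.
move=> /right_inv[Y XY /right_inv[Z YZ _]]; exists Y; split=> //.
suff -> : X = Z by [].
by rewrite -[X]mulmx1 -YZ mulmxA XY mul1mx.
Qed.

Variables (l : nat) (mu : 'I_l -> nat).
Local Notation MX := 'M[series A]_(\sum_a mu a).

Let mask (p : rel 'I_l) (X : 'M[A]_(\sum_a mu a)) : 'M[A]_(\sum_a mu a) :=
  \mxblock_(a, b) (if p a b then submxblock X a b else 0).
Let low : rel 'I_l := fun a b => (b <= a)%N.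
Let upp : rel 'I_l := fun a b => (a < b)%N.

Let maskD X : mask low X + mask upp X = X.
Proof.
rewrite -mxblockD -[RHS]submxblockK; apply/eq_mxblockP => a b.
by rewrite /low /upp; case: ltnP => _; rewrite ?addr0 ?add0r.
Qed.

Let sub_coef a b (X : MX) r :
  coef_mx r (submxblock X a b) = submxblock (coef_mx r X) a b.
Proof. by apply/matrixP => i j; rewrite !mxE. Qed.

Let sub1 a b : submxblock (1%:M : 'M[A]_(\sum_a mu a)) a b =
  if a == b then \matrix_(i, j) (i == j :> nat)%:R else 0.
Proof.
apply/matrixP => i j; rewrite !mxE -val_eqE tagnat.eq_Rank.
by case: eqP => _ /=; rewrite mxE.
Qed.

Fact lower_upper (T : MX) : coef_mx 0 T = 1%:M ->
  exists L U : MX, [/\ T = L *m U,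
    forall a b : 'I_l, (a < b)%N -> submxblock L a b = 0,
    block_upper_unitri U & forall a, coef_mx 0 (submxblock L a a) = 1%:M].
Proof.
move=> T0.
have [f fE] := strong_rec 0 (fun r (g : nat -> 'M[A]_(\sum_a mu a)) =>
  if r is r'.+1 then coef_mx r T
    - \sum_(s < r') mask low (g s.+1) *m mask upp (g (r' - s)%N) else 0).
pose c r (X : 'M[A]_(\sum_a mu a)) := if r is 0 then 1%:M else X.
pose L : MX := mx_of (fun r => c r (mask low (f r))).
pose U : MX := mx_of (fun r => c r (mask upp (f r))).
exists L, U; split.
- apply: coef_mxP => -[|r]; rewrite coef_mxM.
    by rewrite big_ord1 !coef_mx_of /= mulmx1 T0.
  rewrite big_ord_recl big_ord_recr /= subn0 subnn !coef_mx_of /= mul1mx mulmx1.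
  rewrite addrCA addrC -addrA /bump /= add1n addrCA addrA maskD.
  rewrite {1}fE -[LHS](addrNK (\sum_(i < r) mask low (f i.+1) *m
    mask upp (f (r - i)%N))); congr (_ - _ + _); apply: eq_bigr => i _.
    by rewrite !ltnS leq_subr ltn_ord.
  rewrite !coef_mx_of add1n subSS /=.
  by case: (r - i)%N (subn_gt0 i r) => //; rewrite ltn_ord.
- move=> a b ab; apply: coef_mxP => r; rewrite sub_coef coef_mx_of.
  case: r => [|r] /=.
    rewrite sub1 (_ : (a == b) = false); last first.
      by apply/eqP => e; rewrite e ltnn in ab.
    by apply/matrixP => i j; rewrite !mxE.
  rewrite mxblockK /low leqNgt ab /=.
  by apply/matrixP => i j; rewrite !mxE.
- split=> [a|a b ba]; apply: coef_mxP => r; rewrite sub_coef coef_mx_of.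
    case: r => [|r] /=; rewrite coef_mx1.
      by rewrite sub1 eqxx; apply/matrixP => i j; rewrite !mxE.
    by rewrite mxblockK /upp ltnn.
  case: r => [|r] /=.
    rewrite sub1 (_ : (a == b) = false); last first.
      by apply/eqP => e; rewrite e ltnn in ba.
    by apply/matrixP => i j; rewrite !mxE.
  rewrite mxblockK /upp ltnNge ltnW //=.
  by apply/matrixP => i j; rewrite !mxE.
- move=> a; rewrite sub_coef coef_mx_of /= sub1 eqxx.
  by apply/matrixP => i j; rewrite !mxE.
Qed.

Lemma gauss_exists (T : MX) : coef_mx 0 T = 1%:M ->
  exists (F D E : MX) (D' : forall a : 'I_l, 'M[series A]_(mu a)),
    gauss_decomposition T F D E /\
    forall a, inverse_mx (submxblock D a a) (D' a).
Proof.
move=> /lower_upper[L [U [-> Llow Uupp L0]]].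
have [D' D'P] : {D' : forall a, 'M[series A]_(mu a) |
    forall a, inverse_mx (submxblock L a a) (D' a)}.
  exists (fun a => sval (cid (inv_exists (L0 a)))) => a.
  exact: (svalP (cid (inv_exists (L0 a)))).
pose dg (B : forall a, 'M[series A]_(mu a)) : MX := \mxdiag_a B a.
have dg_off B a b : a != b -> submxblock (dg B) a b = 0.
  by move=> ab; rewrite mxblockK (negbTE ab).
have dgM B (X : MX) a b :
    submxblock (dg B *m X) a b = B a *m submxblock X a b.
  by rewrite -{1}[X]submxblockK mul_mxdiag_mxblock mxblockK.
have Mdg B (X : MX) a b :
    submxblock (X *m dg B) a b = submxblock X a b *m B b.
  by rewrite -{1}[X]submxblockK mul_mxblock_mxdiag mxblockK.
pose Ld a := submxblock L a a.
have D'L : dg D' *m dg Ld = 1%:M.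
  rewrite -mxdiagZ -/(dg (fun a => 1%:M)) -[LHS]submxblockK -[RHS]submxblockK.
  apply/eq_mxblockP => a b; rewrite dgM; case: (eqVneq a b) => [<-|ab].
    by rewrite /dg !submxblock_diag (D'P a).2.
  by rewrite !dg_off // mulmx0.
exists (L *m dg D'), (dg Ld), U, D'; split; last first.
  by move=> a; rewrite submxblock_diag.
split=> //.
- by rewrite -[L *m _ *m _]mulmxA D'L mulmx1.
- split=> [a|a b ab]; rewrite Mdg; first by rewrite (D'P a).1.
  by rewrite Llow // mul0mx.
- exact: dg_off.
Qed.
End GaussExists.

Lemma yangian_gauss_exists (K : comNzRingType) (M N l : nat) (mu : 'I_l -> nat)
    (e : (M + N = \sum_a mu a)%N) :
  exists (F D E : 'M[series (yangian K M N)]_(\sum_a mu a))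
    (D' : forall a : 'I_l, 'M[series (yangian K M N)]_(mu a)),
    gauss_decomposition (castmx (e, e) (Tmx K M N)) F D E /\
    forall a, inverse_mx (submxblock D a a) (D' a).
Proof.
apply: gauss_exists; apply/matrixP => i j; rewrite mxE castmxE !mxE /= /tgen /=.
rewrite -(inj_eq (@cast_ord_inj _ _ (esym e)) i j).
by case: eqVneq.
Qed.

(* In the last two constructors [b] is the index a + 1. *)
Inductive parabolic_generator (A : nzRingType) (l : nat) (mu : 'I_l -> nat)
    (F D E : 'M[series A]_(\sum_a mu a))
    (D' : forall a : 'I_l, 'M[series A]_(mu a)) : A -> Prop :=
| ParD (a : 'I_l) (i j : 'I_(mu a)) (r : nat) :
    parabolic_generator F D E D' (scoef (submxblock D a a i j) r)
| ParD' (a : 'I_l) (i j : 'I_(mu a)) (r : nat) :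
    parabolic_generator F D E D' (scoef (D' a i j) r)
| ParE (a b : 'I_l) (i : 'I_(mu a)) (j : 'I_(mu b)) (r : nat)
    of b = a.+1 :> nat & (0 < r)%N :
    parabolic_generator F D E D' (scoef (submxblock E a b i j) r)
| ParF (a b : 'I_l) (i : 'I_(mu b)) (j : 'I_(mu a)) (r : nat)
    of b = a.+1 :> nat & (0 < r)%N :
    parabolic_generator F D E D' (scoef (submxblock F b a i j) r).

(* Main.v *)
Require Import Defs.
From HB Require Import structures.
From mathcomp Require Import all_boot all_order all_algebra.
From mathcomp Require Import monalg.
From mathcomp Require Import reals.
From mathcomp Require Import complex.
From mathcomp Require Import zify.

(** The coefficients [t_ij^(1)] of [T(u)] satisfy the relations of [gl(M|N)], and
    [[t_ij^(r), t_hk^(1)] = +-(delta_hj t_ik^(r) - t_hj^(r) delta_ik)].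
    Comparing coefficients of [u^(-1)] in [T = F D E] gives
    [T^(1) = F^(1) + D^(1) + E^(1)], so the listed elements contain the
    [t_ij^(1)] for [i], [j] in equal or adjacent blocks, and iterated
    commutators produce all [t_ij^(1)].  The first diagonal block of [T] is [D_1], so
    [t_11^(r)] is in the subalgebra for every [r]; its commutators with the
    [t_ij^(1)] then yield every [t_ij^(r)]. *)

Set Implicit Arguments.
Unset Strict Implicit.
Unset Printing Implicit Defensive.

Import GRing.Theory.
Local Open Scope ring_scope.

(** * Block-wise reading of a Gauss decomposition, and its triviality for the identity *)

Section GaussBlocks.
Variables (A : nzRingType) (l : nat) (mu : 'I_l -> nat).
Implicit Types X Y T F D E : 'M[A]_(\sum_a mu a).

Lemma submxblock_mul X Y a b :
  submxblock (X *m Y) a b = \sum_c submxblock X a c *m submxblock Y c b.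
Proof.
by rewrite -{1}[X]submxblockK -{1}[Y]submxblockK mul_mxblock mxblockK.
Qed.

Lemma submxblock1 a : submxblock (1%:M : 'M[A]_(\sum_a mu a)) a a = 1%:M.
Proof.
by apply/matrixP => i j; rewrite !mxE -val_eqE tagnat.eq_Rank eqxx.
Qed.

Lemma submxblock1_neq a b : a != b ->
  submxblock (1%:M : 'M[A]_(\sum_a mu a)) a b = 0.
Proof.
move=> ab; apply/matrixP => i j.
by rewrite !mxE -val_eqE tagnat.eq_Rank (negbTE ab).
Qed.

Lemma gauss_block T F D E (a b : 'I_l) : gauss_decomposition T F D E ->
  submxblock T a b =
    \sum_c submxblock F a c *m submxblock D c c *m submxblock E c b.
Proof.
case=> -> _ Ddiag _; rewrite submxblock_mul; apply: eq_bigr => c _.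
rewrite submxblock_mul (bigD1 c) //= big1 ?addr0 // => d dc.
by rewrite Ddiag // mulmx0.
Qed.

(** In the sum over [c], the hypothesis kills the terms with [c < a] and lower triangularity of [F]
    those with [c > a]; in the remaining term the factor from [F] is 1. *)
Lemma gauss_block_row T F D E (a b : 'I_l) : gauss_decomposition T F D E ->
  (forall c : 'I_l, (c < a)%N -> submxblock F a c = 0) ->
  submxblock T a b = submxblock D a a *m submxblock E a b.
Proof.
move=> G Fa0; rewrite (gauss_block a b G) (bigD1 a) //= big1 ?addr0.
  by case: G => _ [-> _] _ _; rewrite mul1mx.
move=> c ca; have [/Fa0 ->|] := ltnP c a; first by rewrite !mul0mx.
rewrite leq_eqVlt val_eqE eq_sym (negbTE ca) /= => ac.
by case: G => _ [_ ->] // _ _; rewrite !mul0mx.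
Qed.

Lemma gauss_block_col T F D E (a b : 'I_l) : gauss_decomposition T F D E ->
  (forall c : 'I_l, (c < a)%N -> submxblock E c a = 0) ->
  submxblock T b a = submxblock F b a *m submxblock D a a.
Proof.
move=> G Ea0; rewrite (gauss_block b a G) (bigD1 a) //= big1 ?addr0.
  by case: G => _ _ _ [-> _]; rewrite mulmx1.
move=> c ca; have [/Ea0 ->|] := ltnP c a; first by rewrite mulmx0.
rewrite leq_eqVlt val_eqE eq_sym (negbTE ca) /= => ac.
by case: G => _ _ _ [_ ->] //; rewrite mulmx0.
Qed.

(** This is uniqueness of the factorization for the identity, by block elimination; it will pin down
    the constant terms of the factors of [T(u)]. *)
Lemma gauss_decomposition1 F D E : gauss_decomposition 1%:M F D E ->
  [/\ F = 1%:M, D = 1%:M & E = 1%:M].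
Proof.
move=> G; suff H k (a : 'I_l) : a = k :> nat ->
    submxblock D a a = 1%:M /\ forall b, b != a ->
    submxblock E a b = 0 /\ submxblock F b a = 0.
  case: (G) => _ [F1 _] Ddiag [E1 _].
  split; apply/mxblockP => a b; (have [<-|ab] := eqVneq a b;
    [rewrite submxblock1 // | rewrite submxblock1_neq //]).
  - by have [_ /(_ a ab)[]] := H _ b erefl.
  - by have [] := H _ a erefl.
  - by rewrite Ddiag.
  - by rewrite eq_sym in ab; have [_ /(_ b ab)[]] := H _ a erefl.
(* The blocks before [a] have already cleared row [a] of [F] and column [a] of [E] up to the
   diagonal, so the row and column formulas apply at [a]. *)
elim/ltn_ind: k a => k IH a ak.
have Fa0 (c : 'I_l) : (c < a)%N -> submxblock F a c = 0.
  move=> ca; have ac : a != c by apply: contraTneq ca => ->; rewrite ltnn.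
  by rewrite ak in ca; have [_ /(_ a ac)[]] := IH c ca c erefl.
have Ea0 (c : 'I_l) : (c < a)%N -> submxblock E c a = 0.
  move=> ca; have ac : a != c by apply: contraTneq ca => ->; rewrite ltnn.
  by rewrite ak in ca; have [_ /(_ a ac)[]] := IH c ca c erefl.
have Da : submxblock D a a = 1%:M.
  have := gauss_block_row a G Fa0.
  by case: (G) => _ _ _ [-> _]; rewrite submxblock1 mulmx1.
split=> // b ba; split.
  have := gauss_block_row b G Fa0.
  by rewrite submxblock1_neq 1?eq_sym // Da mul1mx.
by have := gauss_block_col b G Ea0; rewrite submxblock1_neq // Da mulmx1.
Qed.

End GaussBlocks.

(** * Low-order coefficients of a Gauss decomposition *)

Section GaussCoefficients.
Variables (A : nzRingType) (l : nat) (mu : 'I_l -> nat).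
Implicit Types T F D E : 'M[series A]_(\sum_a mu a).

Lemma coef_mx_submxblock r T a b :
  coef_mx r (submxblock T a b) = submxblock (coef_mx r T) a b.
Proof. by apply/matrixP => i j; rewrite !mxE. Qed.

Lemma coef_mx0 k k' r : coef_mx r (0 : 'M[series A]_(k, k')) = 0.
Proof. by apply/matrixP => i j; rewrite !mxE; case: r. Qed.

(** The convolution defining a constant term has a single summand, so taking constant terms is
    multiplicative; it also preserves the block shapes. *)
Lemma gauss_coef0 T F D E : gauss_decomposition T F D E ->
  gauss_decomposition (coef_mx 0 T) (coef_mx 0 F) (coef_mx 0 D) (coef_mx 0 E).
Proof.
case=> -> [F1 F0] D0 [E1 E0]; split.
- by rewrite !coef_mxM !big_ord1 coef_mxM big_ord1.
- by split=> [a|a b ab];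
    rewrite -coef_mx_submxblock ?F1 ?F0 ?coef_mx1 ?coef_mx0.
- by move=> a b ab; rewrite -coef_mx_submxblock D0 ?coef_mx0.
- by split=> [a|a b ab];
    rewrite -coef_mx_submxblock ?E1 ?E0 ?coef_mx1 ?coef_mx0.
Qed.

(** All three factors have constant term 1 by uniqueness, so the Leibniz rule for the triple product
    leaves a plain sum. *)
Lemma gauss_coef1 T F D E : coef_mx 0 T = 1%:M -> gauss_decomposition T F D E ->
  coef_mx 1 T = coef_mx 1 F + coef_mx 1 D + coef_mx 1 E.
Proof.
move=> T0 G; have := gauss_coef0 G; rewrite T0.
move=> /gauss_decomposition1[F0 D0 E0]; case: G => -> _ _ _.
rewrite coef_mxM !big_ord_recl big_ord0 /= !coef_mxM !big_ord_recl !big_ord0 /=.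
rewrite !subn0 !subnn F0 D0 E0 /= !mulmx1 !mul1mx !addr0.
by rewrite mul1mx addrC [X in X + _]addrC.
Qed.

End GaussCoefficients.

(** * Commutators with degree-one generators, and generation by all [tgen] *)

Section Generation.
Variables (K : comNzRingType) (M N : nat).
Local Notation Y := (yangian K M N).
Local Notation t := (@tgen K M N).
Implicit Type i j h k : 'I_(M + N).

(** For [s = 1] only the summand [q = 0] is left in the defining relation, and the coefficients of
    index 0 are Kronecker deltas. *)
Lemma tgen_supercomm1 i j h k r : (0 < r)%N ->
  supercomm (par i + par j) (par h + par k) (t i j r) (t h k 1) =
  (-1) ^+ (par i * par j + par i * par h + par j * par h) *
    ((h == j)%:R * t i k r - t h j r * (i == k)%:R).
Proof.
move=> r0; have /eqP := tgen_relation K i j h k r0 (ltn0Sn 0).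
rewrite subr_eq0 => /eqP ->; have -> : minn r 1 = 1%N by lia.
by rewrite big_nat1 subn0 addnK !tgen0.
Qed.

Lemma subalg_closed_sign (A : algType K) (U : {pred A}) n x :
  subalg_closed U -> ((-1) ^+ n * x \in U) = (x \in U).
Proof.
move=> /GRing.subalg_closedBM/GRing.subring_closedB/GRing.zmod_closedN UN.
have Usign y : y \in U -> (-1) ^+ n * y \in U.
  by move=> Uy; rewrite -signr_odd mulr_sign; case: odd => //; exact: UN.
by apply/idP/idP => /Usign; rewrite // mulrA -expr2 sqrr_sign mul1r.
Qed.

(** Every element is the image of a linear combination of words in the free algebra; words are
    handled by induction on their length. *)
Lemma yangian_generated (U : {pred Y}) : subalg_closed U ->
  (forall i j r, (0 < r)%N -> t i j r \in U) -> forall x, x \in U.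
Proof.
move=> Ualg Ut x; have [U1 Ulin UM] := Ualg.
have U0 : 0 \in U by case: (GRing.subalg_closedZ Ualg).
have [p ->] := quot_map_surj x.
rewrite (monalgE p) rmorph_sum /=; elim/big_ind: _ => // [y z Uy Uz|w _].
  by rewrite -[y]scale1r; exact: Ulin.
pose gen w : yangian_free K M N := << w >>.
have -> : << p@_w *g w >> = p@_w *: gen w :> yangian_free K M N.
  by rewrite /gen; apply/malgP => v; rewrite mcoeffZ !mcoeffU mulr_natr.
rewrite linearZ /= -[_ *: _]addr0; apply: (Ulin) => //.
case: w => s; elim: s => [|[[i j] r] s IH].
  have -> : gen (FMonom [::]) = 1 by rewrite /gen -fmoneE.
  by rewrite rmorph1.
have -> : gen (FMonom ((i, j, r) :: s)) = tfree K i j r.+1 * gen (FMonom s).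
  rewrite /gen /= /free_gen [RHS]malgM_def fgmulUU mulr1; congr << _ >>.
  by rewrite fmuE [RHS]fmmulE.
rewrite rmorphM; apply: (UM) => //; exact: (Ut i j r.+1).
Qed.

(** * Spreading membership in a subalgebra from index to index *)

Variable U : {pred Y}.
Hypothesis Ualg : subalg_closed U.

(** A subalgebra is closed under negation, so the signs of the supercommutator and of the relation
    are harmless. *)
Lemma tgen_comm1_in i j h k r : (0 < r)%N -> t i j r \in U -> t h k 1 \in U ->
  (h == j)%:R * t i k r - t h j r * (i == k)%:R \in U.
Proof.
have [_ UB UM] := GRing.subalg_closedBM Ualg.
move=> r0 Ut Ut1; pose n := (par i * par j + par i * par h + par j * par h)%N.
rewrite -(subalg_closed_sign n _ Ualg) -tgen_supercomm1 //.
by apply: UB; rewrite ?(subalg_closed_sign _ _ Ualg); apply: UM.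
Qed.

(** Degree-one elements act like matrix units: with exactly one of the two deltas nonzero, the
    bracket moves a single index. *)
Lemma tgen_comm1_in_right i j k r : (0 < r)%N -> i != k ->
  t i j r \in U -> t j k 1 \in U -> t i k r \in U.
Proof.
move=> r0 ik Ut Ut1; have := tgen_comm1_in r0 Ut Ut1.
by rewrite eqxx (negbTE ik) mul1r mulr0 subr0.
Qed.

Lemma tgen_comm1_in_left i j h r : (0 < r)%N -> h != j ->
  t i j r \in U -> t h i 1 \in U -> t h j r \in U.
Proof.
have /GRing.subring_closedB/GRing.zmod_closedN UN := GRing.subalg_closedBM Ualg.
move=> r0 hj Ut Ut1; have := tgen_comm1_in r0 Ut Ut1.
by rewrite eqxx (negbTE hj) mul0r mulr1 sub0r => /UN; rewrite opprK.
Qed.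

Lemma tgen_all_in o r : (0 < r)%N -> (forall i j, t i j 1 \in U) ->
  t o o r \in U -> forall i j, t i j r \in U.
Proof.
have /GRing.subring_closedB/GRing.zmod_closedD[_ UD] :=
  GRing.subalg_closedBM Ualg.
move=> r0 Ut1 Uo.
have Uio i : t i o r \in U.
  have [-> //|io] := eqVneq i o.
  exact: (tgen_comm1_in_left r0 io Uo).
move=> i j; have [<-|ij] := eqVneq i j; last first.
  exact: (tgen_comm1_in_right r0 ij (Uio i)).
(* On the diagonal both deltas are 1, and the bracket gives the difference of the entries at [i] and
   at [o]; the latter is known. *)
have := tgen_comm1_in r0 (Uio i) (Ut1 o i).
by rewrite !eqxx mul1r mulr1 => /UD/(_ Uo); rewrite subrK.
Qed.

(** Induction on the distance between blocks: a bracket through an index in the block next to that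
    of [j], on the side of [i], shortens it by one. *)
Lemma tgen1_all_in l (blk : 'I_(M + N) -> 'I_l) :
  (forall a, exists i, blk i = a) ->
  (forall i j, (blk i <= (blk j).+1)%N -> (blk j <= (blk i).+1)%N ->
     t i j 1 \in U) ->
  forall i j, t i j 1 \in U.
Proof.
move=> blk_onto Uadj i j.
have neq_blk (x y : 'I_(M + N)) : (blk x < blk y)%N -> x != y /\ y != x.
  by move=> xy; split; apply: contraTneq xy => ->; rewrite ltnn.
(* Subtraction is truncated, so this maximum is the distance between the two blocks; [d] becomes an
   upper bound for it. *)
move: {-1}(maxn _ _) (leqnn (maxn (blk i - blk j) (blk j - blk i))) => d.
elim: d i j => [|d IH] i j dij; first by apply: Uadj; lia.
have [ij1|ij1] := ltnP (blk i).+1 (blk j).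
  have c_lt : ((blk j).-1 < l)%N by have := ltn_ord (blk j); lia.
  have [k /(congr1 val)/= kc] := blk_onto (Ordinal c_lt).
  apply: (@tgen_comm1_in_right i k j) => //; first by case: (neq_blk i j); lia.
    by apply: IH; lia.
  by apply: Uadj; lia.
have [ji1|ji1] := ltnP (blk j).+1 (blk i); last exact: Uadj.
have c_lt : ((blk j).+1 < l)%N by have := ltn_ord (blk i); lia.
have [k /(congr1 val)/= kc] := blk_onto (Ordinal c_lt).
apply: (@tgen_comm1_in_right i k j) => //; first by case: (neq_blk j i); lia.
  by apply: IH; lia.
by apply: Uadj; lia.
Qed.

End Generation.

(** * Generation by the parabolic elements, for any block sizes *)

Lemma parabolic_generation (K : comNzRingType) (M N l : nat) (mu : 'I_l -> nat)
    (e : (M + N = \sum_a mu a)%N)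
    (F D E : 'M[series (yangian K M N)]_(\sum_a mu a))
    (D' : forall a : 'I_l, 'M[series (yangian K M N)]_(mu a)) :
  (forall a, (0 < mu a)%N) ->
  gauss_decomposition (castmx (e, e) (Tmx K M N)) F D E ->
  generates_algebra (parabolic_generator F D E D').
Proof.
move=> mu0 G U Ualg Ugen; set T := castmx _ _ in G.
have [U1 Ulin _] := Ualg.
have U0 : 0 \in U by case: (GRing.subalg_closedZ Ualg).
have UD x y : x \in U -> y \in U -> x + y \in U.
  by move=> Ux; rewrite -[x]scale1r; exact: Ulin.
have TE r i j : tgen K i j r = coef_mx r T (cast_ord e i) (cast_ord e j).
  by rewrite mxE castmxE mxE !cast_ordK.
have T0 : coef_mx 0 T = 1%:M.
  apply/matrixP => x y.
  rewrite -[x](cast_ordKV e) -[y](cast_ordKV e) -TE tgen0 mxE.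
  by rewrite (inj_eq (@cast_ord_inj _ _ e)).
have entry (X : 'M[series (yangian K M N)]_(\sum_a mu a)) r a b
    (i : 'I_(mu a)) (j : 'I_(mu b)) :
    coef_mx r X (tagnat.Rank a i) (tagnat.Rank b j) =
    scoef (submxblock X a b i j) r.
  by rewrite !mxE.
have Ut1 : forall i j, tgen K i j 1 \in U.
  apply: (tgen1_all_in Ualg (blk := fun i => tagnat.sig1 (cast_ord e i))).
    (* Positivity of the parts supplies a first index in each block. *)
    move=> a; exists (cast_ord (esym e) (tagnat.Rank a (Ordinal (mu0 a)))).
    by rewrite cast_ordKV tagnat.Rank1K.
  move=> x y xy yx; rewrite TE; move: (cast_ord e x) (cast_ord e y) xy yx.
  move=> {}x {}y; rewrite -{3}[x]tagnat.sig2K -{3}[y]tagnat.sig2K.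
  move: (tagnat.sig2 x) (tagnat.sig2 y).
  move: (tagnat.sig1 x) (tagnat.sig1 y) => {x y} a b i j ab ba.
  have [_ [F1 Fup] Ddiag [E1 Elow]] := G.
  have scoef1 k (x y : 'I_k) :
      scoef ((1%:M : 'M[series (yangian K M N)]_k) x y) 1 = 0.
    by rewrite mxE; case: (x == y).
  have scoef0 k k' (x : 'I_k) (y : 'I_k') :
      scoef ((0 : 'M[series (yangian K M N)]_(k, k')) x y) 1 = 0.
    by rewrite mxE.
  (* In each position only one of the three summands survives: identity blocks contribute nothing to
     the coefficient of index 1. *)
  rewrite (gauss_coef1 T0 G) mxE [X in X + _]mxE !entry.
  have [ltab|ltba|/val_inj eqab] := ltngtP a b.
  - have ba1 : b = a.+1 :> nat by lia.
    rewrite Fup // Ddiag; last by apply: contraTneq ltab => ->; rewrite ltnn.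
    by rewrite !scoef0 !add0r; apply/Ugen/ParE.
  - have ab1 : a = b.+1 :> nat by lia.
    rewrite Elow // Ddiag; last by apply: contraTneq ltba => ->; rewrite ltnn.
    by rewrite !scoef0 !addr0; apply/Ugen/ParF.
  - case: _ / eqab in j ab ba *.
    by rewrite F1 E1 !scoef1 add0r addr0; apply/Ugen/ParD.
apply: yangian_generated => // i j r r0.
have l0 : (0 < l)%N by have := ltn_ord (tagnat.sig1 (cast_ord e i)); lia.
pose a0 := Ordinal l0; pose i0 := Ordinal (mu0 a0).
apply: (tgen_all_in Ualg (o := cast_ord (esym e) (tagnat.Rank a0 i0))) => //.
(* No block precedes [a0], so the condition on [F] is vacuous. *)
rewrite TE cast_ordKV entry (gauss_block_row a0 G) //.
case: G => _ _ _ [-> _]; rewrite mulmx1; exact/Ugen/ParD.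
Qed.

Theorem theorem1 (R : realType) (M N m n : nat)
    (lambda : 'I_m -> nat) (nu : 'I_n -> nat)
    (hMN : (0 < M + N)%N)
    (hlambda : is_composition lambda M) (hnu : is_composition nu N)
    (F D E : 'M[series (yangian R[i] M N)]_(\sum_a join_comp lambda nu a))
    (D' : forall a : 'I_(m + n),
            'M[series (yangian R[i] M N)]_(join_comp lambda nu a))
    (hgauss : gauss_decomposition
       (castmx (join_comp_sum hlambda hnu, join_comp_sum hlambda hnu)
               (Tmx R[i] M N)) F D E)
    (hD' : forall a, inverse_mx (submxblock D a a) (D' a)) :
  generates_algebra (parabolic_generator F D E D').
Proof.
apply: parabolic_generation hgauss => a; rewrite /join_comp.
by case: split => b; [case: hlambda | case: hnu].
Qed.
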